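(* For all integers $n\geq 0$ and $m\geq 0$, $$B_{5,11}\left(5^{12m}n+\frac{7\cdot 5^{12m}-7}{12}\right)\equiv 2^m B_{5,11}(n)\pmod{11},$$ and, for each $k\in\{4,5\}$, $$B_{5,11}\left(5^{12m+12}n+\frac{(12k+11)\cdot 5^{12m+11}-7}{12}\right)\equiv 0\pmod{11}.$$
   Context: For integers $l,m>1$, an $l$-regular partition is a partition none of whose parts is divisible by $l$. A $(l,m)$-regular bipartition of $n$ is a pair of partitions $(\lambda,\mu)$ such that the sum of all parts of $\lambda$ and $\mu$ is $n$, $\lambda$ is $l$-regular and $\mu$ is $m$-regular. $B_{l,m}(n)$ denotes the number of $(l,m)$-regular bipartitions of $n$; equivalently $\sum_{n\ge 0}B_{l,m}(n)q^n=\frac{f_lf_m}{f_1^2}$, where $f_k=\prod_{j\ge1}(1-q^{jk})$. *)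

(* Defs.v *)
From mathcomp Require Import all_boot.

Set Implicit Arguments.
Unset Strict Implicit.
Unset Printing Implicit Defensive.

(* A partition is the weakly decreasing sequence of its parts. *)
Definition is_partition (s : seq nat) : bool :=
  sorted geq s && all (fun i => 0 < i) s.

Definition is_regular_partition (l : nat) (s : seq nat) : bool :=
  is_partition s && all (fun i => ~~ (l %| i)) s.

Definition is_regular_bipartition (l m n : nat) (p : seq nat * seq nat) : bool :=
  [&& is_regular_partition l p.1, is_regular_partition m p.2
    & sumn p.1 + sumn p.2 == n].

Definition parts (n : nat) (s : n.-bseq 'I_n.+1) : seq nat :=
  [seq val i | i <- s].

(* The members of a bipartition of n have at most n parts, each at most n, so
   counting over a finite type of bounded sequences loses none of them: see
   B_countE below. *)
Definition B (l m n : nat) : nat :=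
  #|[set p : n.-bseq 'I_n.+1 * n.-bseq 'I_n.+1
      | is_regular_bipartition l m n (parts p.1, parts p.2)]|.

Lemma parts_inj n : injective (@parts n).
Proof. by move=> s t /(inj_map val_inj) /val_inj. Qed.

Lemma parts_surj n (s : seq nat) :
  is_partition s -> sumn s <= n -> exists t : n.-bseq 'I_n.+1, parts t = s.
Proof.
case/andP=> _ pos_s le_sn.
have size_s : size s <= n.
  apply: leq_trans le_sn; elim: s pos_s => //= x s IHs /andP[x_gt0 /IHs].
  by rewrite -add1n; apply: leq_add.
have le_parts x : x \in s -> x < n.+1.
  rewrite ltnS => s_x; apply: leq_trans le_sn.
  by rewrite (perm_sumn (perm_to_rem s_x)) leq_addr.
have size_t : size [seq @inord n x | x <- s] <= n by rewrite size_map.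
exists (Bseq size_t); rewrite /parts /= -map_comp -[RHS]map_id.
by apply/eq_in_map => x /le_parts lt_xn /=; rewrite inordK.
Qed.

Lemma B_countE l m n (r : seq (seq nat * seq nat)) :
  uniq r -> (forall p, (p \in r) = is_regular_bipartition l m n p) ->
  size r = B l m n.
Proof.
move=> uniq_r mem_r.
pose f (p : n.-bseq 'I_n.+1 * n.-bseq 'I_n.+1) := (parts p.1, parts p.2).
have inj_f : injective f by move=> [a b] [c d] [/parts_inj-> /parts_inj->].
rewrite /B cardE -(size_map f); apply: perm_size.
apply: uniq_perm => // [|p]; first by rewrite (map_inj_uniq inj_f) enum_uniq.
rewrite mem_r; apply/idP/mapP => [|[q]]; last first.
  by rewrite mem_enum inE => Bq ->.
case: p => s t Bst; case/and3P: (Bst) => /andP[Ps _] /andP[Pt _] /eqP/= def_n.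
have [|a def_s] := parts_surj (n := n) Ps; first by rewrite -def_n leq_addr.
have [|b def_t] := parts_surj (n := n) Pt; first by rewrite -def_n leq_addl.
by exists (a, b); rewrite /f /= ?def_s ?def_t // mem_enum inE /= def_s def_t.
Qed.

(* The divisions by 12 in the arguments of B_{5,11} are exact. *)
Lemma exp5_even_mod12 j : 5 ^ (2 * j) = 1 %[mod 12].
Proof. by rewrite expnM -modnXm exp1n. Qed.

Lemma dvdn_shift1 m : 12 %| 7 * 5 ^ (12 * m) - 7.
Proof.
rewrite -[X in _ %| _ - X]muln1 -mulnBr dvdn_mull // -eqn_mod_dvd ?expn_gt0 //.
by rewrite -[12 * m](mulnA 2 6 m) exp5_even_mod12.
Qed.

Lemma dvdn_shift2 k m : 12 %| (12 * k + 11) * 5 ^ (12 * m + 11) - 7.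
Proof.
have -> : 12 * m + 11 = (2 * (6 * m + 5)).+1 by rewrite mulnDr mulnA -addnS.
rewrite -eqn_mod_dvd; last first.
  by apply: (@leq_trans (11 * 1)) => //; rewrite leq_mul ?leq_addl ?expn_gt0.
rewrite expnS -modnMm -(modnMmr 5) exp5_even_mod12 [12 * k]mulnC modnMDl.
by [].
Qed.

(* Main.v *)
(** Modulo 11 one has f_11 = f_1^11, so the generating function of B_{5,11} is
    f_1^9 f_5.  Let U be the operator keeping every fifth coefficient.  In the
    5-dissection f_1 = A - q f_25 + q^2 C, with A, C power series in q^5, the
    middle term comes from the pentagonal number theorem, A C = - f_25^2 comes
    from the absence of exponents 2 mod 5 in Jacobi's series for f_1^3, and
    taking the product over q -> z q for the fifth roots of unity z, which lie
    in F_11, gives A^5 + q^10 C^5 = f_5^6 / f_25 modulo 11.  Hence U^2 (with the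
    appropriate shifts) acts on the span of f_1^9 f_5 and q f_1^3 f_5^7 by a 2x2
    matrix over F_11 whose sixth power is 2.  Moreover U^11 sends f_1^9 f_5 to a
    multiple of q f_1 f_5^9, whose exponents avoid 0 and 4 mod 5. *)

Require Import Defs.
From HB Require Import structures.
From mathcomp Require Import all_boot all_algebra.
From mathcomp Require Import boolp.
From mathcomp Require Import ring zify.

Set Implicit Arguments.
Unset Strict Implicit.
Unset Printing Implicit Defensive.

Import GRing.Theory.

(** * The ring of formal power series *)

Section PowerSeries.

Local Open Scope ring_scope.

Variable R : comNzRingType.

Record fps := Fps {fps_coef :> nat -> R}.

Lemma fpsP (f g : fps) : f =1 g -> f = g.
Proof. by case: f g => f [g] /= /funext ->. Qed.

HB.instance Definition _ := gen_eqMixin fps.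
HB.instance Definition _ := gen_choiceMixin fps.

Definition fps_zero := Fps (fun=> 0).
Definition fps_add (f g : fps) := Fps (fun n => f n + g n).
Definition fps_opp (f : fps) := Fps (fun n => - f n).
Definition fps_one := Fps (fun n => (n == 0%N)%:R).
Definition fps_mul (f g : fps) :=
  Fps (fun n => \sum_(i < n.+1) f i * g (n - i)%N).

Lemma fps_addA : associative fps_add.
Proof. by move=> f g h; apply/fpsP => n /=; rewrite addrA. Qed.
Lemma fps_addC : commutative fps_add.
Proof. by move=> f g; apply/fpsP => n /=; rewrite addrC. Qed.
Lemma fps_add0 : left_id fps_zero fps_add.
Proof. by move=> f; apply/fpsP => n /=; rewrite add0r. Qed.
Lemma fps_addN : left_inverse fps_zero fps_opp fps_add.
Proof. by move=> f; apply/fpsP => n /=; rewrite addNr. Qed.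

HB.instance Definition _ :=
  GRing.isZmodule.Build fps fps_addA fps_addC fps_add0 fps_addN.

Definition fps_trunc (n : nat) (f : fps) : {poly R} := \poly_(i < n.+1) f i.

Lemma coef_fps_trunc n f i : (i <= n)%N -> (fps_trunc n f)`_i = f i.
Proof. by move=> le_in; rewrite coef_poly ltnS le_in. Qed.

(** A coefficient of a product only involves coefficients of lower or equal degree, so commutativity
    and associativity are inherited from polynomials by truncation. *)
Lemma fps_mul_trunc n m f g : (m <= n)%N ->
  fps_mul f g m = (fps_trunc n f * fps_trunc n g)`_m.
Proof.
move=> le_mn; rewrite coefM /=; apply: eq_bigr => i _.
by rewrite !coef_fps_trunc // (leq_trans _ le_mn) // ?leq_subr // -ltnS.
Qed.

Lemma coefM_low n (p p' r r' : {poly R}) :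
  (forall i, (i <= n)%N -> p`_i = p'`_i) ->
  (forall i, (i <= n)%N -> r`_i = r'`_i) -> (p * r)`_n = (p' * r')`_n.
Proof.
move=> eq_p eq_r; rewrite !coefM; apply: eq_bigr => i _.
by rewrite eq_p ?eq_r // ?leq_subr // -ltnS.
Qed.

Lemma fps_mulC : commutative fps_mul.
Proof.
by move=> f g; apply/fpsP => n; rewrite !(@fps_mul_trunc n) // mulrC.
Qed.

Lemma fps_mulA : associative fps_mul.
Proof.
move=> f g h; apply/fpsP => n; rewrite !(@fps_mul_trunc n) //.
transitivity ((fps_trunc n f * fps_trunc n g * fps_trunc n h)`_n).
  rewrite -mulrA; apply: coefM_low => // i le_in.
  by rewrite coef_fps_trunc // (@fps_mul_trunc n).
apply: coefM_low => // i le_in.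
by rewrite coef_fps_trunc // (@fps_mul_trunc n).
Qed.

Lemma fps_mul1 : left_id fps_one fps_mul.
Proof.
move=> f; apply/fpsP => n; rewrite /= big_ord_recl /= mul1r subn0.
by rewrite big1 ?addr0 // => i _; rewrite mul0r.
Qed.

Lemma fps_mulDl : left_distributive fps_mul fps_add.
Proof.
move=> f g h; apply/fpsP => n /=; rewrite -big_split /=.
by apply: eq_bigr => i _; rewrite mulrDl.
Qed.

Lemma fps_one_neq0 : fps_one != 0.
Proof.
apply/eqP => /(congr1 (fun f : fps => f 0%N)) /= /eqP.
by rewrite (negPf (oner_neq0 R)).
Qed.

HB.instance Definition _ := GRing.Zmodule_isComNzRing.Build fps
  fps_mulA fps_mulC fps_mul1 fps_mulDl fps_one_neq0.

Lemma coef_fps1 n : (1 : fps) n = (n == 0%N)%:R. Proof. by []. Qed.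
Lemma coef_fpsD (f g : fps) n : (f + g) n = f n + g n. Proof. by []. Qed.
Lemma coef_fpsN (f : fps) n : (- f) n = - f n. Proof. by []. Qed.
Lemma coef_fpsM (f g : fps) n :
  (f * g) n = \sum_(i < n.+1) f i * g (n - i)%N.
Proof. by []. Qed.
Lemma coef_fps_sum I (r : seq I) (P : pred I) (f : I -> fps) n :
  (\sum_(i <- r | P i) f i) n = \sum_(i <- r | P i) f i n.
Proof. by apply: (big_morph (fun f : fps => f n)). Qed.
Lemma coef_fps_natr m n : (m%:R : fps) n = m%:R *+ (n == 0%N).
Proof.
elim: m => [|m IHm]; first by rewrite mul0rn.
by rewrite -addn1 !natrD coef_fpsD IHm coef_fps1 mulrnDl.
Qed.

Definition fps_X : fps := Fps (fun n => (n == 1%N)%:R).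

Lemma coef_fpsXM f n : (fps_X * f) n = if n is n'.+1 then f n' else 0.
Proof.
rewrite coef_fpsM big_ord_recl mul0r add0r; case: n => [|n].
  by rewrite big_ord0.
rewrite big_ord_recl /= mul1r subSS subn0 big1 ?addr0 // => i _.
by rewrite mul0r.
Qed.

Lemma coef_fpsXnM m f n :
  (fps_X ^+ m * f) n = if (m <= n)%N then f (n - m)%N else 0.
Proof.
elim: m n => [|m IHm] n; first by rewrite mul1r subn0.
by rewrite exprS -mulrA coef_fpsXM; case: n => [|n] //; rewrite IHm.
Qed.

Lemma coef_fpsXn m n : (fps_X ^+ m) n = (n == m)%:R.
Proof.
rewrite -[_ ^+ m]mulr1 coef_fpsXnM coef_fps1 subn_eq0.
by case: ltngtP.
Qed.

End PowerSeries.

(** * Finite forms of the pentagonal number theorem and of Jacobi's identity for f_1^3 *)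

Section FiniteIdentities.

Local Open Scope ring_scope.

Variables (R : comNzRingType) (x : R).

Definition qpoch (y : R) n : R := \prod_(1 <= j < n.+1) (1 - y ^+ j).

Lemma qpoch0 y : qpoch y 0 = 1.
Proof. by rewrite /qpoch big_geq. Qed.

Lemma qpochS y n : qpoch y n.+1 = qpoch y n * (1 - y ^+ n.+1).
Proof. by rewrite /qpoch big_nat_recr. Qed.

(** The quotient of [qpoch x n] by [qpoch x k], written without division. *)
Definition qpoch_from k n : R := \prod_(k.+1 <= j < n.+1) (1 - x ^+ j).

Lemma qpoch_from_recr k n : (k <= n)%N ->
  qpoch_from k n.+1 = qpoch_from k n * (1 - x ^+ n.+1).
Proof. by move=> le_kn; rewrite /qpoch_from big_nat_recr. Qed.

Lemma qpoch_from_recl k n : (k < n)%N ->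
  qpoch_from k n = (1 - x ^+ k.+1) * qpoch_from k.+1 n.
Proof. by move=> lt_kn; rewrite /qpoch_from big_ltn. Qed.

Definition shanks_term n k : R :=
  (-1) ^+ k * x ^+ (k * n + 'C(k.+1, 2)) * qpoch_from k n.

(* These are k(3k-1)/2 and k(3k+1)/2. *)
Definition pent1 k := (k * k.-1 + 'C(k.+1, 2))%N.
Definition pent2 k := (k * k + 'C(k.+1, 2))%N.

Definition pent_sum (y : R) n : R :=
  1 + \sum_(1 <= k < n.+1) (-1) ^+ k * (y ^+ pent1 k + y ^+ pent2 k).

Lemma pent_sumS y n : pent_sum y n.+1 =
  pent_sum y n + (-1) ^+ n.+1 * (y ^+ pent1 n.+1 + y ^+ pent2 n.+1).
Proof. by rewrite /pent_sum big_nat_recr //= addrA. Qed.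

(** Passing from n to n + 1 changes the partial sums by a single boundary term. At k = n this term
    carries the exponent [pent1 n.+1], while the new summand of index n + 1 carries [pent2 n.+1]. *)
Lemma shanks_telescope n k : (k <= n)%N ->
  \sum_(j < k.+1) shanks_term n.+1 j = \sum_(j < k.+1) shanks_term n j
    + (-1) ^+ k.+1 * x ^+ (k.+1 * n + 'C(k.+2, 2)) * qpoch_from k n.
Proof.
elim: k => [_|k IHk lt_kn].
  rewrite !big_ord1 /shanks_term qpoch_from_recr // !mul0n mul1n binn bin_small //.
  by rewrite !exprD exprS; ring.
rewrite big_ord_recr IHk ?(ltnW lt_kn) // [in RHS]big_ord_recr /= /shanks_term.
rewrite qpoch_from_recr // (qpoch_from_recl lt_kn).
rewrite -!addrA; congr (_ + _).
have e1 : (k.+1 * n.+1 + 'C(k.+2, 2) = k.+1 * n + 'C(k.+2, 2) + k.+1)%N by lia.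
have e2 : (k.+2 * n + 'C(k.+3, 2) = k.+1 * n + 'C(k.+2, 2) + k.+1 + n.+1)%N.
  by rewrite [in LHS]binS bin1; lia.
rewrite e1 e2 !(exprD x (_ + _)) (exprS (-1) k.+1).
by ring.
Qed.

(* Shanks's finite form of the pentagonal number theorem. *)
Lemma shanks_sum n : \sum_(k < n.+1) shanks_term n k = pent_sum x n.
Proof.
elim: n => [|n IHn].
  rewrite big_ord1 /shanks_term /pent_sum /qpoch_from !big_geq //.
  by rewrite mul0n add0n bin_small // !expr0 !mulr1 addr0.
rewrite big_ord_recr /= shanks_telescope // IHn pent_sumS /shanks_term /qpoch_from.
by rewrite !big_geq // /pent1 /pent2 /= -addrA !mulr1 -mulrDr.
Qed.

(* The Gaussian binomial coefficient [a+b, a]. *)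
Fixpoint qbox a : nat -> R :=
  fix qbox_a b := match a, b with
  | a'.+1, b'.+1 => qbox a' b'.+1 + x ^+ a * qbox_a b'
  | _, _ => 1
  end.

Arguments qbox : simpl never.

Lemma qbox0n b : qbox 0 b = 1. Proof. by case: b. Qed.
Lemma qboxn0 a : qbox a 0 = 1. Proof. by case: a. Qed.

Lemma qboxSS a b :
  qbox a.+1 b.+1 = qbox a b.+1 + x ^+ a.+1 * qbox a.+1 b.
Proof. by []. Qed.

(** The mirror q-Pascal rule, by expanding both sides with the two rules at smaller a + b. It yields
    the symmetry of [qbox]. *)
Lemma qboxSS' a b :
  qbox a.+1 b.+1 = x ^+ b.+1 * qbox a b.+1 + qbox a.+1 b.
Proof.
move def_s: (a + b)%N => s; elim: s a b def_s => [|s IHs] [|a] [|b] // def_s.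
- by rewrite qboxSS !qbox0n !qboxn0; ring.
- rewrite qboxSS {1}IHs; last by lia.
  by rewrite [qbox 1 b.+1]qboxSS !qbox0n !exprS; ring.
- rewrite qboxSS {1}IHs; last by lia.
  by rewrite [qbox a.+1 1]qboxSS !qboxn0 !exprS; ring.
rewrite qboxSS {1}IHs; last by lia.
rewrite {1}[qbox a.+2 b.+1]IHs; last by lia.
rewrite [qbox a.+1 b.+2]qboxSS [qbox a.+2 b.+1]qboxSS !exprS.
by ring.
Qed.

Lemma qboxC a b : qbox a b = qbox b a.
Proof.
move def_s: (a + b)%N => s; elim: s a b def_s => [|s IHs] [|a] [|b] // def_s.
rewrite qboxSS qboxSS' addrC (IHs a b.+1) ?(IHs a.+1 b) //; lia.
Qed.

(** The product formula for Gaussian binomials, cleared of denominators so that it holds in any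
    ring. *)
Lemma qbox_qpoch a b : qbox a b * qpoch x a * qpoch x b = qpoch x (a + b).
Proof.
move def_s: (a + b)%N => s; elim: s a b def_s => [|s IHs] [|a] [|b] // def_s.
- by rewrite !qpoch0 qbox0n !mulr1.
- by rewrite qbox0n qpoch0 !mul1r -def_s.
- by rewrite qboxn0 qpoch0 mulr1 mul1r -def_s addn0.
rewrite qboxSS mulrDl mulrDl [qpoch x a.+1]qpochS.
rewrite mulrA mulrAC IHs; last by lia.
have -> : x ^+ a.+1 * qbox a.+1 b * (qpoch x a * (1 - x ^+ a.+1)) * qpoch x b.+1
  = x ^+ a.+1 * (1 - x ^+ b.+1) * (qbox a.+1 b * qpoch x a.+1 * qpoch x b).
  by rewrite !qpochS; ring.
rewrite IHs; last by lia.
by rewrite qpochS -def_s exprD; ring.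
Qed.

(** The defining Pascal rule is applied once, then the mirror rule on each of the two terms; both
    contribute to the middle term. *)
Lemma qbox_step a b : qbox a.+2 b.+2 = x ^+ b.+2 * qbox a b.+2
  + (1 + x ^+ (a + b).+3) * qbox a.+1 b.+1 + x ^+ a.+2 * qbox a.+2 b.
Proof.
rewrite qboxSS (qboxSS' a) (qboxSS' a.+1 b).
have -> : (a + b).+3 = (a.+2 + b.+1)%N by lia.
by rewrite exprD; ring.
Qed.

(* The coefficients x^(k(k+1)/2) [2n+1, n-k] of the finite Jacobi triple
   product.
   The recurrence jacobi_termSS, obtained from two steps of Pascal's rule, makes
   their sum against (-1)^k (2k+1) telescope. *)
Definition jacobi_term n k : R :=
  if (k <= n)%N then x ^+ 'C(k.+1, 2) * qbox (n - k) (n + k).+1 else 0.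

(** This is the recurrence of [jacobi_termSS] at index -1 + 1: the symmetry k -> -1 - k of the
    coefficients identifies the term of index -1 with that of index 0. *)
Lemma jacobi_termS0 n : jacobi_term n.+1 0 =
  (1 + x ^+ n.+1 + x ^+ n.+1 * x ^+ n.+1) * jacobi_term n 0
  + x ^+ n.+1 * jacobi_term n 1.
Proof.
rewrite /jacobi_term !addn0 !subn0 /=; case: n => [|n].
  by rewrite !qboxSS !qbox0n qboxn0 /=; ring.
rewrite qbox_step [qbox n.+2 n.+1]qboxC subSS subn0 addn1.
have -> : (n + n.+1).+3 = (n.+2 + n.+2)%N by lia.
by rewrite exprD !exprS expr0 ltn0Sn; ring.
Qed.

Lemma jacobi_termSS n k : jacobi_term n.+1 k.+1 = x ^+ n.+1 * jacobi_term n k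
  + (1 + x ^+ n.+1 * x ^+ n.+1) * jacobi_term n k.+1 + x ^+ n.+1 * jacobi_term n k.+2.
Proof.
rewrite /jacobi_term ltnS; case: (leqP k n) => [le_kn | lt_nk]; last first.
  by rewrite !ifN; [ring | lia..].
have [a def_n] : exists a, n = (a + k)%N by exists (n - k)%N; lia.
have bin_k : ('C(k.+2, 2) = 'C(k.+1, 2) + k.+1)%N by rewrite binS bin1; lia.
have bin_k1 : ('C(k.+3, 2) = 'C(k.+2, 2) + k.+2)%N by rewrite binS bin1; lia.
(* The two-step rule needs n - k >= 2. For n - k = 0 or 1 some terms on the right are out of range,
   hence 0, and the identity is checked directly. *)
case: a def_n => [|[|a]] def_n.
- rewrite !ifN; [|lia..]; rewrite def_n !add0n !subnn !qbox0n bin_k exprD; ring.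
- rewrite ifT; last by lia.
  rewrite ifN; last by lia.
  have -> : (n.+1 - k.+1 = 1)%N by lia.
  have -> : (n - k = 1)%N by lia.
  have -> : (n - k.+1 = 0)%N by lia.
  have -> : (n.+1 + k.+1).+1 = ((n + k).+1).+2 by lia.
  rewrite !qbox0n qboxSS [qbox 1 _.+2]qboxSS' !qbox0n def_n bin_k.
  have -> : (1 + k + k).+2 = (k.+1 + k.+2)%N by lia.
  by rewrite !add1n !exprD !exprS; ring.
rewrite !ifT; [|lia..].
have -> : (n.+1 - k.+1 = a.+2)%N by lia.
have -> : (n - k = a.+2)%N by lia.
have -> : (n - k.+1 = a.+1)%N by lia.
have -> : (n - k.+2 = a)%N by lia.
have -> : (n.+1 + k.+1).+1 = ((n + k).+1).+2 by lia.
rewrite qbox_step.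
have -> : (n + k.+2).+1 = (n + k).+1.+2 by lia.
have -> : (n + k.+1).+1 = (n + k).+1.+1 by lia.
have -> : (a + (n + k).+1).+3 = (n.+1 + n.+1)%N by lia.
rewrite bin_k1 bin_k.
have -> : n.+1 = (a.+2 + k.+1)%N by lia.
have -> : (n + k).+1.+2 = (a.+2 + k.+1 + k.+2)%N by lia.
by rewrite !exprD; ring.
Qed.

Lemma jacobi_term_telescope n k :
  \sum_(j < k.+1) (-1) ^+ j * j.*2.+1%:R * jacobi_term n.+1 j =
  (1 - x ^+ n.+1) ^+ 2 * (\sum_(j < k.+1) (-1) ^+ j * j.*2.+1%:R * jacobi_term n j)
  + x ^+ n.+1 * (-1) ^+ k
    * (k.*2.+3%:R * jacobi_term n k + k.*2.+1%:R * jacobi_term n k.+1).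
Proof.
elim: k => [|k IHk].
  by rewrite !big_ord1 jacobi_termS0 /= double0; ring.
rewrite big_ord_recr IHk [in RHS]big_ord_recr /= jacobi_termSS doubleS.
by rewrite -!natr1 !(exprS (-1)); ring.
Qed.

Lemma jacobi_term_sum n :
  \sum_(k < n.+1) (-1) ^+ k * k.*2.+1%:R * jacobi_term n k = qpoch x n ^+ 2.
Proof.
have jacobi_term_big m k : (m < k)%N -> jacobi_term m k = 0.
  by move=> lt_mk; rewrite /jacobi_term leqNgt lt_mk.
elim: n => [|n IHn].
  by rewrite big_ord1 /jacobi_term /= double0 qpoch0 expr1n !mulr1.
(* Summing up to k = n + 1 kills both boundary terms, so each step in n multiplies the sum by (1 -
   x^(n+1))^2. *)
rewrite jacobi_term_telescope big_ord_recr /= IHn !jacobi_term_big // qpochS.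
by ring.
Qed.

End FiniteIdentities.

(** * Agreement of series up to a given degree, and the limits of the finite identities *)

Section Agree.

Local Open Scope ring_scope.

Variable R : comNzRingType.
Implicit Types f g h : fps R.

Definition agree N f g := forall n, (n <= N)%N -> f n = g n.

Lemma agree_sym N f g : agree N f g -> agree N g f.
Proof. by move=> fg n /fg. Qed.

Lemma agree_trans N g f h : agree N f g -> agree N g h -> agree N f h.
Proof. by move=> fg gh n le_n; rewrite fg ?gh. Qed.

Lemma agreeW N M f g : (N <= M)%N -> agree M f g -> agree N f g.
Proof. by move=> le_NM fg n le_n; apply/fg/(leq_trans le_n). Qed.

Lemma agreeP f g : (forall N, agree N f g) -> f = g.
Proof. by move=> fg; apply/fpsP => n; apply: (fg n). Qed.

Lemma agreeD N f f' g g' :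
  agree N f f' -> agree N g g' -> agree N (f + g) (f' + g').
Proof. by move=> ff gg n le_n; rewrite !coef_fpsD ff ?gg. Qed.

Lemma agreeM N f f' g g' :
  agree N f f' -> agree N g g' -> agree N (f * g) (f' * g').
Proof.
move=> ff gg n le_n; rewrite !coef_fpsM; apply: eq_bigr => i _.
by rewrite ff ?gg // (leq_trans _ le_n) ?leq_subr // -ltnS.
Qed.

Lemma agreeX N f g m : agree N f g -> agree N (f ^+ m) (g ^+ m).
Proof. by move=> fg; elim: m => // m IHm; rewrite !exprS; apply: agreeM. Qed.

Lemma agree_sum N I (r : seq I) (P : pred I) (f g : I -> fps R) :
  (forall i, P i -> agree N (f i) (g i)) ->
  agree N (\sum_(i <- r | P i) f i) (\sum_(i <- r | P i) g i).
Proof.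
move=> fg n le_n; rewrite !coef_fps_sum.
by apply: eq_bigr => i Pi; apply: fg.
Qed.

(** Multiplication by h is unitriangular on coefficients, so they are recovered one after the
    other. *)
Lemma agree_mull N h f g : h 0%N = 1 -> agree N (h * f) (h * g) -> agree N f g.
Proof.
move=> h0 hfg n; elim/ltn_ind: n => n IHn le_nN.
have := hfg n le_nN; rewrite !coef_fpsM !big_ord_recl h0 !mul1r subn0.
set s := \sum_(i < n) h (lift ord0 i) * f _%N.
suff -> : s = \sum_(i < n) h (lift ord0 i) * g (n - lift ord0 i)%N by exact: addIr.
apply: eq_bigr => i _; rewrite IHn //; have := ltn_ord i; rewrite /= /bump; lia.
Qed.

Lemma fps_mull h f g : h 0%N = 1 -> h * f = h * g -> f = g.
Proof.
by move=> h0 hfg; apply: agreeP => N; apply: (agree_mull h0); rewrite hfg.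
Qed.

Lemma agree_XnM N m f g :
  agree (N - m) f g -> agree N (fps_X R ^+ m * f) (fps_X R ^+ m * g).
Proof.
move=> fg n le_n; rewrite !coef_fpsXnM; case: leqP => // le_mn.
by apply: fg; rewrite leq_sub2r.
Qed.

Lemma agree_XnM0 N m f : (N < m)%N -> agree N (fps_X R ^+ m * f) 0.
Proof. by move=> lt_Nm n le_n; rewrite coef_fpsXnM ifN //; lia. Qed.

(** The infinite product f_1: factors beyond the n-th do not affect the coefficient of degree n. *)
Definition euler := Fps (fun n => qpoch (fps_X R) n n).

Lemma agree_prod (P : pred nat) N M : (N <= M)%N ->
  agree N (\prod_(1 <= j < N.+1 | P j) (1 - fps_X R ^+ j))
          (\prod_(1 <= j < M.+1 | P j) (1 - fps_X R ^+ j)).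
Proof.
move=> /subnKC <-; elim: (M - N)%N => [|m IHm]; first by rewrite addn0.
apply: agree_trans IHm _; rewrite addnS [X in agree _ _ X]big_mkcond.
rewrite big_nat_recr //= -big_mkcond /=; set f := \prod_(_ <= _ < _ | _) _.
case: ifP => _; rewrite ?mulr1 // mulrBr mulr1 mulrC -{1}[f]subr0.
apply: agreeD => // n le_n; rewrite !coef_fpsN; congr (- _).
by apply/esym/(@agree_XnM0 N) => //; lia.
Qed.

Lemma agree_euler N M : (N <= M)%N -> agree N euler (qpoch (fps_X R) M).
Proof.
move=> le_NM n le_n; rewrite /euler /=.
by apply: (agree_prod predT) (leqnn n); apply: leq_trans le_NM.
Qed.

Lemma euler0 : euler 0%N = 1. Proof. by rewrite /= qpoch0. Qed.

(** In Shanks's sum the term of index 0 is the product of the first n factors, and a term of index k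
    >= 1 is divisible by q to the power kn + k(k+1)/2 > n. *)
Lemma euler_pentagonal n : agree n euler (pent_sum (fps_X R) n).
Proof.
rewrite -shanks_sum big_ord_recl /= -[euler]addr0; apply: agreeD.
  rewrite /shanks_term mul0n bin_small // !expr0 !mul1r; exact: agree_euler.
apply: agree_sym; apply: (@agree_trans _ (\sum_(k < n) 0)); last by rewrite big1.
apply: agree_sum => k _; rewrite /shanks_term mulrAC mulrC.
apply: agree_XnM0; rewrite /= /bump /= add1n binS bin1; lia.
Qed.

(** After multiplication by f_1, the product formula for [qbox] has f_1 as limit on both sides: a
    Gaussian binomial approximates 1/f_1. *)
Lemma agree_euler_qbox a b :
  (a <= b)%N -> agree a (euler * qbox (fps_X R) a b) 1.
Proof.
move=> le_ab; apply: (agree_mull euler0); rewrite mulr1 mulrA mulrC.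
apply: (@agree_trans _
  (qbox (fps_X R) a b * qpoch (fps_X R) a * qpoch (fps_X R) b)).
  rewrite -!mulrA; apply: agreeM => //.
  by apply: agreeM; apply: agree_euler.
by rewrite qbox_qpoch; apply/agree_sym/agree_euler/leq_addr.
Qed.

Definition jacobi_sum n : fps R :=
  \sum_(k < n.+1) (-1) ^+ k * k.*2.+1%:R * fps_X R ^+ 'C(k.+1, 2).

Lemma euler_jacobi n : agree n (euler ^+ 3) (jacobi_sum n).
Proof.
apply: (@agree_trans _ (euler * qpoch (fps_X R) n ^+ 2)).
  by rewrite exprS; apply: agreeM => //; apply/agreeX/agree_euler.
rewrite -jacobi_term_sum mulr_sumr; apply: agree_sum => k _.
rewrite mulrCA; apply: agreeM => //.
have le_kn : (k <= n)%N by rewrite -ltnS.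
rewrite /jacobi_term le_kn mulrCA -[X in agree _ _ X]mulr1.
(* The [qbox] factor is only controlled up to degree n - k, which suffices because it comes with
   q^(k(k+1)/2) and k(k+1)/2 >= k. *)
apply: agree_XnM; apply: agreeW (agree_euler_qbox _); last by lia.
case: (nat_of_ord k) => [|k']; first lia.
by rewrite binS bin1; lia.
Qed.

End Agree.

(** * Operators on series: q -> q^5, extraction of a residue class modulo 5, and q -> c q *)

Section Dissection.

Local Open Scope ring_scope.

Variable R : comNzRingType.
Implicit Types f g h : fps R.

Notation q := (fps_X R).

Definition dil5 f := Fps (fun n => if (5 %| n)%N then f (n %/ 5)%N else 0).

Lemma dil5_zmod_morphism : zmod_morphism dil5.
Proof.
by move=> f g; apply/fpsP => n /=; case: ifP; rewrite ?subr0.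
Qed.

Lemma dil5_monoid_morphism : monoid_morphism dil5.
Proof.
split=> [|f g]; apply/fpsP => n.
  rewrite /=; case: (n =P 0%N) => [->//|n_neq0].
  by case: ifP => // dv5n; rewrite (_ : (n %/ 5 == 0)%N = false) //; lia.
rewrite [RHS](@fps_mul_trunc _ n) //.
pose p f := fps_trunc n f.
(* Multiplicativity comes from composition of the truncated polynomials with X^5. *)
transitivity (((p f \Po 'X^5) * (p g \Po 'X^5))`_n); last first.
  apply: coefM_low => i le_in; rewrite coef_comp_poly_Xn // !coef_fps_trunc //=;
  lia.
rewrite -rmorphM coef_comp_poly_Xn //=; case: ifP => // _.
by rewrite -(@fps_mul_trunc _ n) //; lia.
Qed.

HB.instance Definition _ :=
  GRing.isZmodMorphism.Build (fps R) (fps R) dil5 dil5_zmod_morphism.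
HB.instance Definition _ :=
  GRing.isMonoidMorphism.Build (fps R) (fps R) dil5 dil5_monoid_morphism.

Lemma coef_dil5 f n : dil5 f (5 * n)%N = f n.
Proof. by rewrite /= dvdn_mulr // mulKn. Qed.

Lemma dil5_inj : injective dil5.
Proof. by move=> f g fg; apply/fpsP => n; rewrite -[LHS]coef_dil5 fg coef_dil5. Qed.

Lemma dil5_X : dil5 q = q ^+ 5.
Proof.
apply/fpsP => n; rewrite coef_fpsXn /=; case: ifP => [/dvdnP[m ->]|].
  by rewrite mulnK // (@eqn_pmul2r 5 m 1).
by case: eqP => // ->.
Qed.

Lemma agree_dil5 N f g : agree N f g -> agree (5 * N)%N (dil5 f) (dil5 g).
Proof.
by move=> fg n le_n /=; case: ifP => // _; apply: fg; lia.
Qed.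

Lemma dil5_qpoch f n : dil5 (qpoch f n) = qpoch (dil5 f) n.
Proof.
by rewrite rmorph_prod; apply: eq_bigr => j _; rewrite rmorphB rmorph1 rmorphXn.
Qed.

Lemma dil5_pent_sum f n : dil5 (pent_sum f n) = pent_sum (dil5 f) n.
Proof.
rewrite rmorphD rmorph1 rmorph_sum; congr (_ + _); apply: eq_bigr => j _.
by rewrite rmorphM rmorphXn rmorphN1 rmorphD !rmorphXn.
Qed.

Definition sect5 r f := Fps (fun n => f (5 * n + r)%N).

Lemma coef_sect5 r f n : sect5 r f n = f (5 * n + r)%N.
Proof. by []. Qed.

Lemma sect5_zmod_morphism r : zmod_morphism (sect5 r).
Proof. by move=> f g; apply/fpsP. Qed.

HB.instance Definition _ r :=
  GRing.isZmodMorphism.Build (fps R) (fps R) (sect5 r) (sect5_zmod_morphism r).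

Lemma sect5D r f g : sect5 r (f + g) = sect5 r f + sect5 r g.
Proof. exact: raddfD. Qed.

Lemma agree_sect5 N r f g :
  agree (5 * N + r)%N f g -> agree N (sect5 r f) (sect5 r g).
Proof. by move=> fg n le_n; apply: fg; rewrite leq_add2r leq_mul2l. Qed.

Lemma sect5_XnV r s f : (r < 5)%N -> (s < 5)%N ->
  sect5 r (q ^+ s * dil5 f) = if r == s then f else 0.
Proof.
move=> lt_r5 lt_s5; apply/fpsP => n; rewrite coef_sect5 coef_fpsXnM.
case: (r =P s) => [->|neq_rs].
  by rewrite leq_addl addnK coef_dil5.
by case: ifP => //= le_s; rewrite ifN //; lia.
Qed.

Lemma sect5_Xn r e : (r < 5)%N ->
  sect5 r (q ^+ e) = if (e %% 5 == r)%N then q ^+ (e %/ 5)%N else 0.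
Proof.
move=> lt_r5; rewrite {1}(divn_eq e 5) addnC exprD mulnC exprM -dil5_X -rmorphXn.
by rewrite sect5_XnV // ?ltn_mod // eq_sym.
Qed.

Lemma sect5_sum f : f = dil5 (sect5 0 f) + q * dil5 (sect5 1 f)
  + q ^+ 2 * dil5 (sect5 2 f) + q ^+ 3 * dil5 (sect5 3 f)
  + q ^+ 4 * dil5 (sect5 4 f).
Proof.
set g := RHS; have g_sect r : (r < 5)%N -> sect5 r g = sect5 r f.
  move=> lt_r5; rewrite /g -[X in X + q * _]mul1r -(expr0 q).
  rewrite -[X in X * dil5 (sect5 1 f)]expr1.
  rewrite !raddfD /= !sect5_XnV //.
  by case: r lt_r5 => [|[|[|[|[|]]]]] //= _; rewrite ?addr0 ?add0r.
apply/fpsP => n; have := g_sect (n %% 5)%N (@ltn_pmod n 5 isT).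
move/(congr1 (fun h : fps R => h (n %/ 5)%N)).
by rewrite !coef_sect5 mulnC -divn_eq.
Qed.

(** Linearity over series in q^5: this is how powers of f_5 leave a section as powers of f_1. *)
Lemma sect5_dil5M r f g : (r < 5)%N -> sect5 r (dil5 f * g) = f * sect5 r g.
Proof.
move=> lt_r5; rewrite {1}(sect5_sum g) !mulrDr !raddfD /=.
have -> : dil5 f * dil5 (sect5 0 g) = q ^+ 0 * dil5 (f * sect5 0 g).
  by rewrite rmorphM mul1r.
have -> : dil5 f * (q * dil5 (sect5 1 g)) = q ^+ 1 * dil5 (f * sect5 1 g).
  by rewrite rmorphM mulrCA.
rewrite ![dil5 f * (q ^+ _ * _)]mulrCA -!rmorphM !sect5_XnV //.
by case: r lt_r5 => [|[|[|[|[|]]]]] //= _; rewrite ?addr0 ?add0r.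
Qed.

Definition scale_var c f := Fps (fun n => c ^+ n * f n).

Lemma scale_var_zmod_morphism c : zmod_morphism (scale_var c).
Proof. by move=> f g; apply/fpsP => n; rewrite /= mulrBr. Qed.

Lemma scale_var_monoid_morphism c : monoid_morphism (scale_var c).
Proof.
split=> [|f g]; apply/fpsP => n; rewrite /= ?coef_fps1.
  by case: n => [|n]; rewrite ?mulr0 ?mulr1.
rewrite mulr_sumr; apply: eq_bigr => i _.
by rewrite mulrACA -exprD subnKC // -ltnS.
Qed.

HB.instance Definition _ c := GRing.isZmodMorphism.Build
  (fps R) (fps R) (scale_var c) (scale_var_zmod_morphism c).
HB.instance Definition _ c := GRing.isMonoidMorphism.Build
  (fps R) (fps R) (scale_var c) (scale_var_monoid_morphism c).

Lemma scale_var_X m : scale_var m%:R q = m%:R * q.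
Proof.
apply/fpsP => n; rewrite mulrC coef_fpsXM; case: n => [|n] /=.
  by rewrite mulr0.
by rewrite coef_fps_natr eqSS; case: n => [|n] /=; rewrite ?mulr1 ?mulr0.
Qed.

Lemma agree_scale_var N c f g :
  agree N f g -> agree N (scale_var c f) (scale_var c g).
Proof. by move=> fg n le_n; rewrite /= fg. Qed.

Lemma scale_var_dil5 c f : c ^+ 5 = 1 -> scale_var c (dil5 f) = dil5 f.
Proof.
move=> c5; apply/fpsP => n /=; case: ifP => [/dvdnP[m ->]|]; last by rewrite mulr0.
by rewrite mulnC exprM c5 expr1n mul1r.
Qed.

Lemma scale_var_qpoch c f n :
  scale_var c (qpoch f n) = qpoch (scale_var c f) n.
Proof.
by rewrite rmorph_prod; apply: eq_bigr => j _; rewrite rmorphB rmorph1 rmorphXn.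
Qed.

Notation E := (euler R).

Lemma sect5_signM r k f : sect5 r ((-1) ^+ k * f) = (-1) ^+ k * sect5 r f.
Proof. exact: raddfMsign. Qed.

Lemma pent1_2 m : (2 * pent1 m + m = 3 * (m * m))%N.
Proof.
rewrite /pent1; case: m => // m.
have : (2 * 'C(m.+2, 2) = m.+2 * m.+1)%N.
  by rewrite -mul_bin_diag bin1 /=; lia.
rewrite /=; lia.
Qed.

Lemma pent2_2 m : (2 * pent2 m = 3 * (m * m) + m)%N.
Proof.
have : (2 * 'C(m.+1, 2) = m.+1 * m)%N.
  by rewrite -mul_bin_diag bin1 /=; lia.
rewrite /pent2; lia.
Qed.

End Dissection.

(** * Sections of f_1 and f_1^3 modulo 5 *)

Section EulerSections.

Local Open Scope ring_scope.

Variable R : comNzRingType.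
Implicit Types f g h : fps R.

Notation q := (fps_X R).
Notation V := (@dil5 R).
Notation E := (euler R).

Lemma sect5_pent_sum_term r k : (r < 5)%N ->
  sect5 r ((-1) ^+ k * (q ^+ pent1 k + q ^+ pent2 k)) =
  (-1) ^+ k * ((if (pent1 k %% 5 == r)%N then q ^+ (pent1 k %/ 5)%N else 0)
    + (if (pent2 k %% 5 == r)%N then q ^+ (pent2 k %/ 5)%N else 0)).
Proof. by move=> lt_r5; rewrite sect5_signM raddfD /= !sect5_Xn. Qed.

(** Generalized pentagonal numbers are 0, 1 or 2 modulo 5, by cases on k modulo 5. *)
Lemma sect5_pent_sum0 r n : (2 < r < 5)%N -> sect5 r (pent_sum q n) = 0.
Proof.
case/andP=> lt_2r lt_r5; rewrite raddfD raddf_sum /= big1 => [|k _].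
  by rewrite addr0 -(expr0 q) sect5_Xn // ifN //; lia.
have := pent1_2 k; have := pent2_2 k.
have := divn_eq k 5; have := ltn_pmod k (isT : 0 < 5)%N.
move: (k %/ 5)%N (k %% 5)%N => m i lt_i5 def_k e2 e1.
rewrite sect5_pent_sum_term // !ifN ?addr0 ?mulr0 //;
  case: i lt_i5 def_k => [|[|[|[|[|]]]]] // _ def_k; subst k; lia.
Qed.

(** The pentagonal exponents that are 1 modulo 5 are 1 and, for m >= 1, [pent2] (5m-1) = 25
    [pent1 m] + 1 and [pent1] (5m+1) = 25 [pent2 m] + 1. The indices 5m-1 and 5m+1 have the parity
    opposite to m, hence the sign. *)
Lemma sect5_pent_sum1 n :
  sect5 1 (pent_sum q (5 * n + 1)%N) = - V (pent_sum q n).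
Proof.
have p1 := pent1_2; have p2 := pent2_2.
rewrite dil5_pent_sum dil5_X; elim: n => [|n IHn].
  rewrite muln0 add0n /pent_sum big_nat1 big_geq // sect5D sect5_pent_sum_term //.
  by rewrite -(expr0 q) sect5_Xn //= /pent1 /pent2 /=; ring.
(* Going from n to n + 1 adds the indices 5n+2 to 5n+6; only 5n+4 and 5n+6 contribute. *)
have -> : (5 * n.+1 + 1 = (5 * n + 1).+4.+1)%N by lia.
rewrite !pent_sumS 5!sect5D !sect5_pent_sum_term // IHn.
have [p1n p2n] := (p1 n.+1, p2 n.+1).
have [p12 p22] := (p1 (5 * n + 1).+1%N, p2 (5 * n + 1).+1%N).
have [p13 p23] := (p1 (5 * n + 1).+2%N, p2 (5 * n + 1).+2%N).
have [p14 p24] := (p1 (5 * n + 1).+3%N, p2 (5 * n + 1).+3%N).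
have [p15 p25] := (p1 (5 * n + 1).+4%N, p2 (5 * n + 1).+4%N).
have [p16 p26] := (p1 (5 * n + 1).+4.+1%N, p2 (5 * n + 1).+4.+1%N).
have -> : (pent2 (5 * n + 1).+3 %% 5 == 1)%N by lia.
have -> : (pent1 (5 * n + 1).+4.+1 %% 5 == 1)%N by lia.
have -> : (pent2 (5 * n + 1).+3 %/ 5 = 5 * pent1 n.+1)%N by lia.
have -> : (pent1 (5 * n + 1).+4.+1 %/ 5 = 5 * pent2 n.+1)%N by lia.
rewrite !ifN; [|lia..].
have sgn a b : odd a = odd b -> (-1) ^+ a = (-1) ^+ b :> fps R.
  by move=> odd_ab; rewrite -signr_odd odd_ab signr_odd.
rewrite (sgn (5 * n + 1).+3%N n); last by lia.
rewrite (sgn (5 * n + 1).+4.+1%N n); last by lia.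
by rewrite -!exprM (exprS _ n); ring.
Qed.

Lemma sect5_euler0 r : (2 < r < 5)%N -> sect5 r E = 0.
Proof.
move=> r_bounds; apply: agreeP => N; rewrite -(@sect5_pent_sum0 r (5 * N + r)%N) //.
exact/agree_sect5/euler_pentagonal.
Qed.

Lemma sect5_euler1 : sect5 1 E = - V E.
Proof.
apply: agreeP => N; apply: (@agree_trans _ _ (- V (pent_sum q N))).
  by rewrite -sect5_pent_sum1; apply/agree_sect5/euler_pentagonal.
move=> n le_n; rewrite !coef_fpsN; congr (- _); apply/esym.
apply: (agree_dil5 (@euler_pentagonal _ N)); lia.
Qed.

(** Triangular numbers are 0, 1 or 3 modulo 5. *)
Lemma sect5_jacobi_sum2 n : sect5 2 (jacobi_sum R n) = 0.
Proof.
rewrite raddf_sum /= big1 // => k _.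
rewrite -mulrA sect5_signM mulr_natl raddfMn /= sect5_Xn // ifN ?mul0rn ?mulr0 //.
have : (2 * 'C(k.+1, 2) = k.+1 * k)%N by rewrite -mul_bin_diag bin1.
have := divn_eq k 5; have := ltn_pmod k (isT : 0 < 5)%N.
move: (nat_of_ord k) => j; move: (j %/ 5)%N (j %% 5)%N => m i lt_i5 def_j.
case: i lt_i5 def_j => [|[|[|[|[|]]]]] // _ def_j; subst j; lia.
Qed.

Lemma sect5_euler3_2 : sect5 2 (E ^+ 3) = 0.
Proof.
apply: agreeP => N; rewrite -(@sect5_jacobi_sum2 (5 * N + 2)%N).
exact/agree_sect5/euler_jacobi.
Qed.

Lemma sect5_comb f0 f1 f2 f3 f4 r : (r < 5)%N ->
  sect5 r (V f0 + q * V f1 + q ^+ 2 * V f2 + q ^+ 3 * V f3 + q ^+ 4 * V f4)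
  = nth 0 [:: f0; f1; f2; f3; f4] r.
Proof.
move=> lt_r5; rewrite -[V f0]mul1r -(expr0 q) -[X in X * V f1]expr1.
rewrite !sect5D !sect5_XnV //.
by case: r lt_r5 => [|[|[|[|[|]]]]] //= _; rewrite ?addr0 ?add0r.
Qed.

Lemma qpochS5 (S : comNzRingType) (y : S) n : qpoch y (5 * n.+1)%N =
  qpoch y (5 * n)%N * (1 - y ^+ (5 * n + 1)%N) * (1 - y ^+ (5 * n + 2)%N)
   * (1 - y ^+ (5 * n + 3)%N) * (1 - y ^+ (5 * n + 4)%N)
   * (1 - y ^+ (5 * n + 5)%N).
Proof.
have -> : (5 * n.+1 = (5 * n).+4.+1)%N by lia.
by rewrite !qpochS !addnS addn0.
Qed.

(** * Products over the fifth roots of unity in characteristic 11 *)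

Section Char11.

Variable S : comNzRingType.
Hypothesis char11 : 11%:R = 0 :> S.

(** Turns a congruence modulo 11 into an integral identity for [ring]; in each use, z is the
    difference of the two sides divided by 11. *)
Lemma eq_mod11 (x y z : S) : x = y + 11%:R * z -> x = y.
Proof. by rewrite char11 mul0r addr0. Qed.

Lemma natr_mod11 n : n%:R = (n %% 11)%:R :> S.
Proof. by rewrite {1}(divn_eq n 11) natrD natrM char11 mulr0 add0r. Qed.

(* 1, 3, 9, 5, 4 are the fifth roots of unity modulo 11, and the factors are
   multiplied in conjugate pairs. *)
Lemma norm5 (u v w : S) :
  (u + v + w) * (u + 3%:R * v + 3%:R ^+ 2 * w) * (u + 9%:R * v + 9%:R ^+ 2 * w)
    * (u + 5%:R * v + 5%:R ^+ 2 * w) * (u + 4%:R * v + 4%:R ^+ 2 * w)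
  = u ^+ 5 + v ^+ 5 + w ^+ 5 - 5%:R * u * v ^+ 3 * w + 5%:R * u ^+ 2 * v * w ^+ 2.
Proof.
pose x := u ^+ 2 + v ^+ 2 + w ^+ 2; pose y := u * v + v * w; pose z := u * w.
have e1 : (u + 3%:R * v + 3%:R ^+ 2 * w) * (u + 4%:R * v + 4%:R ^+ 2 * w)
    = x + 7%:R * y + 3%:R * z.
  apply: (@eq_mod11 _ _ (v ^+ 2 + 13%:R * w ^+ 2 + 2%:R * u * w + 7%:R * v * w)).
  by rewrite /x /y /z; ring.
have e2 : (u + 9%:R * v + 9%:R ^+ 2 * w) * (u + 5%:R * v + 5%:R ^+ 2 * w)
    = x + 3%:R * y + 7%:R * z.
  apply: (@eq_mod11 _ _
    (4%:R * v ^+ 2 + 184%:R * w ^+ 2 + u * v + 9%:R * u * w + 57%:R * v * w)).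
  by rewrite /x /y /z; ring.
transitivity ((u + v + w) *
    ((x + 7%:R * y + 3%:R * z) * (x + 3%:R * y + 7%:R * z))).
  by rewrite -e1 -e2; ring.
apply: (@eq_mod11 _ _ ((u + v + w) * 
  (x * y + x * z + 2%:R * y ^+ 2 + 2%:R * z ^+ 2 + 5%:R * y * z))).
by rewrite /x /y /z; ring.
Qed.

Lemma norm5_1 (y : S) :
  (1 - y) * (1 - 3%:R * y) * (1 - 9%:R * y) * (1 - 5%:R * y) * (1 - 4%:R * y)
  = 1 - y ^+ 5.
Proof.
transitivity (1 ^+ 5 + (- y) ^+ 5 + 0 ^+ 5 - 5%:R * 1 * (- y) ^+ 3 * 0
  + 5%:R * 1 ^+ 2 * (- y) * 0 ^+ 2); last by ring.
by rewrite -norm5; ring.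
Qed.

(** The five factors of index j multiply to 1 - x^(5j) when 5 does not divide j, and to (1 - x^j)^5
    when it does. The last factor on the left supplies the missing 1 - x^(25i). *)
Lemma qpoch_norm (x : S) n :
  qpoch x (5 * n)%N * qpoch (3%:R * x) (5 * n)%N * qpoch (9%:R * x) (5 * n)%N
    * qpoch (5%:R * x) (5 * n)%N * qpoch (4%:R * x) (5 * n)%N
    * qpoch ((x ^+ 5) ^+ 5) n
  = qpoch (x ^+ 5) n ^+ 5 * qpoch (x ^+ 5) (5 * n)%N.
Proof.
(* For a fifth root of unity d, only the residue i of the exponent modulo 5 matters; below, r lists
   the powers of 3, 9, 5 and 4 modulo 11. *)
have pow (d i r m : nat) : (d ^ 5 %% 11 = 1)%N -> (d ^ i %% 11 = r)%N ->
    (d%:R * x) ^+ (5 * m + i)%N = r%:R * x ^+ (5 * m + i)%N.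
  move=> d5 di; rewrite exprMn exprD exprM -natrX (natr_mod11 (d ^ 5)) d5 expr1n mul1r.
  by rewrite -natrX (natr_mod11 (d ^ i)) di.
elim: n => [|n IHn]; first by rewrite muln0 !qpoch0 !mulr1 expr1n.
have e5 i : (x ^+ 5) ^+ (5 * n + i)%N = (x ^+ (5 * n + i)%N) ^+ 5.
  by rewrite -!exprM mulnC.
rewrite !qpochS5 (qpochS (x ^+ 5)) (qpochS ((x ^+ 5) ^+ 5)).
rewrite (pow 3 1 3)%N // (pow 3 2 9)%N // (pow 3 3 5)%N //
  (pow 3 4 4)%N // (pow 3 5 1)%N //.
rewrite (pow 9 1 9)%N // (pow 9 2 4)%N // (pow 9 3 3)%N //
  (pow 9 4 5)%N // (pow 9 5 1)%N //.
rewrite (pow 5 1 5)%N // (pow 5 2 3)%N // (pow 5 3 4)%N //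
  (pow 5 4 9)%N // (pow 5 5 1)%N //.
rewrite (pow 4 1 4)%N // (pow 4 2 5)%N // (pow 4 3 9)%N //
  (pow 4 4 3)%N // (pow 4 5 1)%N //.
rewrite !e5 -(exprM (x ^+ 5) 5 n.+1) -(exprM x 5 n.+1).
have -> : (5 * n.+1 = 5 * n + 5)%N by lia.
rewrite e5.
set y1 := x ^+ (5 * n + 1)%N; set y2 := x ^+ (5 * n + 2)%N.
set y3 := x ^+ (5 * n + 3)%N; set y4 := x ^+ (5 * n + 4)%N.
set y5 := x ^+ (5 * n + 5)%N.
transitivity (qpoch x (5 * n)%N * qpoch (3%:R * x) (5 * n)%N
    * qpoch (9%:R * x) (5 * n)%N * qpoch (5%:R * x) (5 * n)%N
    * qpoch (4%:R * x) (5 * n)%N * qpoch ((x ^+ 5) ^+ 5) n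
    * ((1 - y1) * (1 - 3%:R * y1) * (1 - 9%:R * y1) * (1 - 5%:R * y1)
      * (1 - 4%:R * y1))
    * ((1 - y2) * (1 - 3%:R * y2) * (1 - 9%:R * y2) * (1 - 5%:R * y2)
      * (1 - 4%:R * y2))
    * ((1 - y3) * (1 - 3%:R * y3) * (1 - 9%:R * y3) * (1 - 5%:R * y3)
      * (1 - 4%:R * y3))
    * ((1 - y4) * (1 - 3%:R * y4) * (1 - 9%:R * y4) * (1 - 5%:R * y4)
      * (1 - 4%:R * y4))
    * ((1 - y5) ^+ 5 * (1 - y5 ^+ 5))).
  move: (qpoch x _) (qpoch (3%:R * x) _) (qpoch (9%:R * x) _).
  move: (qpoch (5%:R * x) _) (qpoch (4%:R * x) _) (qpoch _ n) => p1 p2 p3 p4 p5 p6.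
  by ring.
rewrite !norm5_1 IHn.
move: (qpoch _ n) (qpoch _ (5 * n)%N) => p1 p2.
by ring.
Qed.

End Char11.

(** * The 5-dissections of powers of f_1 modulo 11 *)

Hypothesis char11 : 11%:R = 0 :> R.

Lemma fps_char11 : 11%:R = 0 :> fps R.
Proof. by apply/fpsP => n; rewrite coef_fps_natr char11 mul0rn. Qed.

(** In the 5-dissection f_1 = A - q f_25 + q^2 C, the series A, -f_25 and C are [V a], [V b] and
    [V c]. *)
Let a := sect5 0 E.
Let c := sect5 2 E.
Let b := - V E.

Lemma euler_dissection : E = V a + q * V b + q ^+ 2 * V c.
Proof.
rewrite {1}(sect5_sum E) (@sect5_euler0 3) // (@sect5_euler0 4) // sect5_euler1.
by rewrite !raddf0 !mulr0 !addr0.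
Qed.

Lemma euler_sect0_2 : a * c = - b ^+ 2.
Proof.
have : sect5 2 (E ^+ 3) = a * (3%:R * (a * c + b ^+ 2)).
  rewrite euler_dissection.
  pose e0 := a ^+ 3 + 3%:R * q * b * c ^+ 2.
  pose e1 := 3%:R * a ^+ 2 * b + q * c ^+ 3.
  pose e2 := a * (3%:R * (a * c + b ^+ 2)).
  pose e3 := 6%:R * a * b * c + b ^+ 3.
  pose e4 := 3%:R * b ^+ 2 * c + 3%:R * a * c ^+ 2.
  rewrite (_ : _ ^+ 3 = V e0 + q * V e1 + q ^+ 2 * V e2 + q ^+ 3 * V e3
    + q ^+ 4 * V e4) ?sect5_comb // /e0 /e1 /e2 /e3 /e4.
  rewrite !(rmorph_nat, rmorphD, rmorphM, rmorphXn) /= dil5_X.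
  by ring.
rewrite sect5_euler3_2 -(mulr0 a).
have a0 : a 0%N = 1 by rewrite coef_sect5 euler0.
(* The factor a is cancelled because its constant term is 1, and 4 is the inverse of 3 modulo 11. *)
move/(fps_mull a0)/(congr1 (fun f => 4%:R * f)); rewrite mulr0 => eq0.
apply/eqP; rewrite -subr_eq0 opprK eq0; apply/eqP/esym.
by apply: (eq_mod11 fps_char11 (z := a * c + b ^+ 2)); ring.
Qed.

Lemma euler_norm : (a ^+ 5 + q ^+ 2 * c ^+ 5) * V E = E ^+ 6.
Proof.
(* The product over q -> z q is a series in q^5, so the comparison is made after q -> q^5; [S m] is
   the substitution q -> m q. *)
apply: dil5_inj.
pose S (m : nat) := @scale_var R m%:R.
have scaleE m : m%:R ^+ 5 = 1 :> R ->
    S m E = V a + m%:R * (q * V b) + m%:R ^+ 2 * (q ^+ 2 * V c).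
  move=> m5; rewrite /S {1}euler_dissection !rmorphD !rmorphM /=.
  by rewrite !scale_var_dil5 // scale_var_X; ring.
have root5 m : (m ^ 5 %% 11 = 1)%N -> m%:R ^+ 5 = 1 :> R.
  by move=> m5; rewrite -natrX (natr_mod11 char11) m5.
have prodS : E * S 3%N E * S 9%N E * S 5%N E * S 4%N E * V (V E) = V E ^+ 6.
  apply: agreeP => N; pose P n := qpoch q n.
  have agE : agree N E (P (5 * N)%N) by apply: agree_euler; lia.
  apply: (@agree_trans _ _ (P (5 * N)%N * S 3%N (P (5 * N)%N)
      * S 9%N (P (5 * N)%N) * S 5%N (P (5 * N)%N) * S 4%N (P (5 * N)%N)
      * V (V (P N)))).
    apply: agreeM.
      by do 4![apply: agreeM; last exact: agree_scale_var].
    by apply: (agreeW _ (agree_dil5 (agree_dil5 (agree_euler _ (leqnn N))))); lia.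
  rewrite /S /P !scale_var_qpoch !dil5_qpoch !scale_var_X dil5_X rmorphXn /= dil5_X.
  rewrite (qpoch_norm fps_char11) -dil5_X -!dil5_qpoch (exprSr (V E) 5).
  apply: agree_sym.
  apply: agreeM; first apply: agreeX.
    by apply: agreeW (agree_dil5 (agree_euler _ (leqnn N))); lia.
  by apply: agreeW (agree_dil5 agE); lia.
rewrite rmorphXn /= -prodS !scaleE ?root5 //.
rewrite [X in _ = X * _ * _ * _ * _ * _]euler_dissection.
rewrite (norm5 fps_char11) !(rmorphD, rmorphM, rmorphXn) /= dil5_X.
congr (_ * _).
have ac : V a * V c = - V b ^+ 2.
  by rewrite -rmorphM euler_sect0_2 rmorphN rmorphXn.
set u := V a; set v := q * V b; set w := q ^+ 2 * V c.
have uw : u * w = - v ^+ 2 by rewrite /u /w mulrCA ac /v; ring.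
transitivity (u ^+ 5 + w ^+ 5); first by rewrite /u /w; ring.
(* Since u w = -v^2, the terms of the norm that involve v add up to (1 + 5 + 5) v^5 = 11 v^5. *)
apply: esym; apply: (eq_mod11 fps_char11 (z := v ^+ 5)).
transitivity (u ^+ 5 + v ^+ 5 + w ^+ 5 - 5%:R * v ^+ 3 * (u * w)
  + 5%:R * v * (u * w) ^+ 2); first by ring.
by rewrite uw; ring.
Qed.

(** The components of f_1^3. The relation a c = -b^2 reduces 6abc + b^3 to -5b^3 and kills the
    component 3c(b^2 + ac) of residue 4. *)
Let e0 := a ^+ 3 + 3%:R * q * b * c ^+ 2.
Let e1 := 3%:R * a ^+ 2 * b + q * c ^+ 3.
Let e3 := - (5%:R * b ^+ 3).

Lemma euler3_dissection : E ^+ 3 = V e0 + q * V e1 + q ^+ 3 * V e3.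
Proof.
rewrite {1}euler_dissection /e0 /e1 /e3.
rewrite [V (- (_ * _))]rmorphN.
rewrite !(rmorph_nat, rmorphD, rmorphM, rmorphXn) /= dil5_X.
have ac : V a * V c + V b ^+ 2 = 0.
  by rewrite -rmorphM euler_sect0_2 rmorphN rmorphXn addNr.
set x := V a; set y := V b; set z := V c.
transitivity (x ^+ 3 + 3%:R * q ^+ 5 * y * z ^+ 2
   + q * (3%:R * x ^+ 2 * y + q ^+ 5 * z ^+ 3) - q ^+ 3 * (5%:R * y ^+ 3)
   + (x * z + y ^+ 2) * (3%:R * q ^+ 2 * x + 6%:R * q ^+ 3 * y + 3%:R * q ^+ 4 * z)).
  by ring.
by rewrite ac; ring.
Qed.

Lemma sect5_qEuler : sect5 2 (q * E) = - V E.
Proof.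
rewrite (_ : q * E = V 0 + q * V a + q ^+ 2 * V b + q ^+ 3 * V c + q ^+ 4 * V 0).
  by rewrite sect5_comb.
by rewrite {1}euler_dissection raddf0; ring.
Qed.

Lemma sect5_qEuler3 : sect5 4 (q * E ^+ 3) = 5%:R * V E ^+ 3.
Proof.
rewrite (_ : q * E ^+ 3 = V 0 + q * V e0 + q ^+ 2 * V e1 + q ^+ 3 * V 0
    + q ^+ 4 * V e3).
  by rewrite sect5_comb // [nth _ _ _]/= /e3 /b; ring.
by rewrite euler3_dissection raddf0; ring.
Qed.

(** The component [f4] of the cubed dissection of f_1^3 can be written with b, ac and a^5 + q^2 c^5
    only, which are -f_5, -f_5^2 and f_1^6 / f_5. *)
Lemma sect5_euler9 :
  sect5 4 (E ^+ 9) = 9%:R * V E ^+ 3 * E ^+ 6 + 2%:R * q * V E ^+ 9.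
Proof.
pose f0 := e0 ^+ 3 + 3%:R * q * e1 ^+ 2 * e3.
pose f1 := 3%:R * e0 ^+ 2 * e1 + 3%:R * q * e0 * e3 ^+ 2.
pose f2 := 3%:R * e0 * e1 ^+ 2 + 3%:R * q * e1 * e3 ^+ 2.
pose f3 := e1 ^+ 3 + 3%:R * e0 ^+ 2 * e3.
pose f4 := 6%:R * e0 * e1 * e3 + q * e3 ^+ 3.
rewrite (_ : E ^+ 9 = V f0 + q * V f1 + q ^+ 2 * V f2 + q ^+ 3 * V f3
    + q ^+ 4 * V f4); last first.
  rewrite (exprM E 3 3) euler3_dissection /f0 /f1 /f2 /f3 /f4.
  rewrite !(rmorph_nat, rmorphD, rmorphM, rmorphXn) /= dil5_X.
  by move: (V e0) (V e1) (V e3) => x y z; ring.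
rewrite sect5_comb // [nth _ _ _]/= /f4.
transitivity (- (90%:R * b ^+ 4 * (a ^+ 5 + q ^+ 2 * c ^+ 5))
  - 30%:R * q * b ^+ 3 * (a * c) ^+ 3 - 270%:R * q * b ^+ 5 * (a * c) ^+ 2
  - 125%:R * q * b ^+ 9); first by rewrite /e0 /e1 /e3; ring.
rewrite euler_sect0_2 -euler_norm.
apply: (eq_mod11 fps_char11 (z := - (9%:R * V E ^+ 4 * (a ^+ 5 + q ^+ 2 * c ^+ 5))
  + 33%:R * q * V E ^+ 9)).
by rewrite /b; ring.
Qed.

(** The same reduction, for f_1^7 as the square of the dissection of f_1^3 times that of f_1. *)
Lemma sect5_euler7 :
  sect5 2 (E ^+ 7) = 3%:R * V E * E ^+ 6 + 4%:R * q * V E ^+ 7.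
Proof.
pose f0 := e0 ^+ 2 * a + q * (2%:R * e0 * e3 * c + 2%:R * e1 * e3 * b).
pose f1 := e0 ^+ 2 * b + 2%:R * e0 * e1 * a
  + q * (e3 ^+ 2 * a + 2%:R * e1 * e3 * c).
pose f2 := e0 ^+ 2 * c + 2%:R * e0 * e1 * b + e1 ^+ 2 * a + q * e3 ^+ 2 * b.
pose f3 := 2%:R * e0 * e1 * c + e1 ^+ 2 * b + 2%:R * e0 * e3 * a
  + q * e3 ^+ 2 * c.
pose f4 := e1 ^+ 2 * c + 2%:R * e0 * e3 * b + 2%:R * e1 * e3 * a.
rewrite (_ : E ^+ 7 = V f0 + q * V f1 + q ^+ 2 * V f2 + q ^+ 3 * V f3
    + q ^+ 4 * V f4); last first.
  rewrite (exprD E 6 1) (exprM E 3 2) euler3_dissection expr1.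
  rewrite [in X in _ * X]euler_dissection /f0 /f1 /f2 /f3 /f4.
  rewrite !(rmorph_nat, rmorphD, rmorphM, rmorphXn) /= dil5_X.
  move: (V e0) (V e1) (V e3) (V a) (V b) (V c) => x y z a' b' c'.
  by ring.
rewrite sect5_comb // [nth _ _ _]/= /f2.
transitivity (a ^+ 5 * (a * c) + 15%:R * a ^+ 5 * b ^+ 2
  + 14%:R * q * b * (a * c) ^+ 3 + 18%:R * q * b ^+ 3 * (a * c) ^+ 2
  + 15%:R * q ^+ 2 * b ^+ 2 * c ^+ 5 + q ^+ 2 * (a * c) * c ^+ 5
  + 25%:R * q * b ^+ 7); first by rewrite /e0 /e1 /e3; ring.
rewrite euler_sect0_2 -euler_norm.
apply: (eq_mod11 fps_char11
  (z := V E ^+ 2 * (a ^+ 5 + q ^+ 2 * c ^+ 5) - 3%:R * q * V E ^+ 7)).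
by rewrite /b; ring.
Qed.

End EulerSections.

(** * Enumeration of regular partitions and bipartitions *)

Section Enumeration.

Variable l : nat.

(* The l-regular partitions of n into parts at most k; the fuel N must be at
   least k + n. *)
Fixpoint rparts N k n : seq (seq nat) :=
  match N, k with
  | N'.+1, k'.+1 => rparts N' k' n ++
      (if ~~ (l %| k) && (k <= n) then map (cons k) (rparts N' k (n - k))
       else [::])
  | _, _ => if n == 0 then [:: [::]] else [::]
  end.

Lemma regular_partition_cons x s : is_regular_partition l (x :: s) =
  [&& 0 < x, ~~ (l %| x), all (fun i => i <= x) s & is_regular_partition l s].
Proof.
rewrite /is_regular_partition /is_partition /= path_sortedE; last first.
  by move=> b a c ab bc; apply: leq_trans bc ab.
rewrite -/(all (fun i => i <= x) s).
by case: (0 < x); case: (l %| x); case: (sorted geq s);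
  case: (all (fun i => i <= x) s); rewrite ?andbF ?andbT.
Qed.

(** A partition into parts at most k + 1 either has all parts at most k, or starts with k + 1 and
    continues with parts at most k + 1. *)
Lemma mem_rparts N k n s : k + n <= N ->
  (s \in rparts N k n) =
  [&& is_regular_partition l s, all (fun i => i <= k) s & sumn s == n].
Proof.
elim: N k n s => [|N IHN] k n s.
  rewrite leqn0 addn_eq0 => /andP[/eqP-> /eqP->].
  case: s => [|x s] //=; rewrite regular_partition_cons.
  by case: x => [|x]; rewrite ?andbF.
case: k => [_|k le_kn_N] /=.
  case: s => [|x s]; first by case: n.
  rewrite regular_partition_cons /=.
  by case: x => [|x]; rewrite ?andbF ?andFb; case: (n == 0).
rewrite mem_cat IHN; last by lia.
case: s => [|x s].
  rewrite /=; case: ifP => _; rewrite ?in_nil ?orbF //.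
  by rewrite (_ : [::] \in _ = false) ?orbF //; apply/mapP => -[].
rewrite regular_partition_cons /=.
have mem_cons y (u : seq (seq nat)) :
    (y :: s \in map (cons k.+1) u) = (y == k.+1) && (s \in u).
  apply/mapP/andP => [[t ut [-> ->]] | [/eqP-> us]]; first by rewrite eqxx.
  by exists s.
case: (ltngtP x k.+1) => [lt_xk | gt_xk | ->].
- have neq_xk : (x == k.+1) = false by lia.
  rewrite (_ : x <= k); last by lia.
  case: (boolP (all (fun i => i <= x) s)) => [le_sx | _]; rewrite ?andbF ?andFb /=.
    rewrite (_ : all (fun i => i <= k) s); last first.
      by apply: sub_all le_sx => i; lia.
    rewrite (_ : all (fun i => i <= k.+1) s); last first.
      by apply: sub_all le_sx => i; lia.
    case: ifP => _; rewrite ?in_nil ?orbF // mem_cons.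
    by rewrite neq_xk andFb orbF.
  by case: ifP => _; rewrite ?in_nil // mem_cons neq_xk.
- have neq_xk : (x == k.+1) = false by lia.
  rewrite (_ : x <= k = false); last by lia.
  rewrite !andFb !andbF /=; case: ifP => _; rewrite ?in_nil // mem_cons.
  by rewrite neq_xk.
rewrite ltnn !andFb andbF /=.
case: (boolP (l %| k.+1)) => dvd_lk //=.
case: ifP => [le_kn | /negbT gt_kn].
  rewrite mem_cons eqxx IHN /=; last by lia.
  rewrite -(eqn_add2l k.+1) subnKC //.
  by case: (all _ s); rewrite ?andbF ?andbT.
by rewrite (_ : (_ == n) = false) ?andbF //; lia.
Qed.

Lemma uniq_rparts N k n : k + n <= N -> uniq (rparts N k n).
Proof.
elim: N k n => [|N IHN] [|k] n //=; try by case: (n == 0).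
move=> le_kn_N; rewrite cat_uniq IHN /=; last by lia.
case: ifP => [/andP[_ le_kn] | _] //.
rewrite map_inj_uniq ?IHN ?andbT; [|lia|by move=> s t []].
apply/hasPn => s /mapP[t _ ->] /=.
rewrite mem_rparts /=; last by lia.
by rewrite ltnn !andbF.
Qed.

Definition nparts k n := size (rparts (k + n) k n).

Lemma size_rparts N k n : k + n <= N -> size (rparts N k n) = nparts k n.
Proof.
move=> le_N; apply: perm_size; apply: uniq_perm; rewrite ?uniq_rparts // => s.
by rewrite !mem_rparts.
Qed.

Lemma npartsS k n : nparts k.+1 n = nparts k n +
  (if ~~ (l %| k.+1) && (k < n) then nparts k.+1 (n - k.+1) else 0).
Proof.
rewrite {1}/nparts addSn /= size_cat -/(nparts k n); congr (_ + _).
by case: ifP => // /andP[_ lt_kn]; rewrite size_map size_rparts //; lia.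
Qed.

Lemma nparts_stable k n : n <= k -> nparts k n = nparts n n.
Proof.
move=> /subnKC <-; elim: (k - n) => [|d IHd]; first by rewrite addn0.
by rewrite addnS npartsS IHd ltnNge leq_addr andbF addn0.
Qed.

End Enumeration.

(** Bipartitions are listed according to the sum i of the first component; [B_countE] then equates
    the length of the list with [B]. *)
Lemma B_nparts l m n :
  B l m n = \sum_(i < n.+1) nparts l i i * nparts m (n - i) (n - i).
Proof.
pose t i := [seq (x, y) | x <- rparts l (i + i) i i,
                          y <- rparts m ((n - i) + (n - i)) (n - i) (n - i)].
have mem_t i p : (p \in t i) = [&& is_regular_partition l p.1,
    is_regular_partition m p.2, sumn p.1 == i & sumn p.2 == n - i].
  have all_le (s : seq nat) : all (fun j => j <= sumn s) s.
    elim: s => //= x s IHs; rewrite leq_addr; apply: sub_all IHs => j; lia.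
  have mem_diag d j s : (s \in rparts d (j + j) j j)
      = is_regular_partition d s && (sumn s == j).
    rewrite mem_rparts //; case: eqP => [<-|]; rewrite ?andbF // all_le.
    by rewrite !andbT.
  case: p => x y /=; apply/allpairsP/and4P => [[[x' y'] /=] | [lx my sx sy]].
    by case; rewrite !mem_diag => /andP[lx sx] /andP[my sy] [-> ->].
  by exists (x, y); rewrite /= !mem_diag lx sx my sy.
have uniq_t i : uniq (t i).
  by apply: allpairs_uniq; rewrite ?uniq_rparts // => -[? ?] [? ?] _ _.
pose r := [seq p | i <- iota 0 n.+1, p <- t i].
have mem_r p : (p \in r) = is_regular_bipartition l m n p.
  apply/allpairsPdep/and3P => [[i [q [i_n]]] | [lx my /eqP def_n]].
    rewrite mem_t => /and4P[lx my /eqP sx /eqP sy] ->; split => //.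
    by rewrite sx sy; move: i_n; rewrite mem_iota; lia.
  exists (sumn p.1), p; rewrite mem_iota mem_t lx my eqxx /=; split => //; lia.
have uniq_r : uniq r.
  apply: allpairs_uniq_dep => [|i _|]; rewrite ?iota_uniq ?uniq_t //.
  move=> u v /allpairsPdep[i [p [_ ti ->]]] /allpairsPdep[j [p' [_ tj ->]]] /=.
  move=> eq_p; move: ti tj; rewrite -eq_p !mem_t.
  by move=> /and4P[_ _ /eqP <- _] /and4P[_ _ /eqP <- _].
rewrite -(B_countE uniq_r mem_r) size_allpairs_dep sumnE big_map.
rewrite -[n.+1]subn0 -/(index_iota 0 n.+1) big_mkord; apply: eq_bigr => i _.
by rewrite size_allpairs.
Qed.

(** * The generating function of B_{5,11} modulo 11 *)

Section GeneratingFunction.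

Local Open Scope ring_scope.

Variable R : comNzRingType.

Notation q := (fps_X R).
Notation V := (@dil5 R).
Notation E := (euler R).

Definition npartsF l k := Fps (fun n => (nparts l k n)%:R : R).
Definition regularF l := Fps (fun n => (nparts l n n)%:R : R).

Definition qmult l k : fps R := \prod_(1 <= j < k.+1 | (l %| j)%N) (1 - q ^+ j).

(** The recurrence [npartsS] says that allowing the part k + 1 divides the series by 1 - q^(k+1)
    when l does not divide k + 1, and changes nothing otherwise. *)
Lemma npartsF_qpoch l k : npartsF l k * qpoch q k = qmult l k.
Proof.
elim: k => [|k IHk].
  rewrite qpoch0 mulr1 /qmult big_geq //.
  by apply/fpsP => n; rewrite coef_fps1 /= /nparts add0n; case: n.
rewrite qpochS /qmult big_mkcond big_nat_recr //= -big_mkcond /= -/(qmult l k).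
rewrite -IHk; case: ifP => dvd_lk.
  rewrite mulrA; congr (_ * _ * _); apply/fpsP => n.
  by rewrite /= npartsS dvd_lk addn0.
rewrite mulr1 mulrCA [RHS]mulrC; congr (_ * _).
rewrite mulrC mulrBl mul1r; apply/fpsP => n; rewrite coef_fpsD coef_fpsN coef_fpsXnM.
rewrite /= npartsS dvd_lk /=; case: ifP => _; last by rewrite addn0 subr0.
by rewrite natrD addrK.
Qed.

Lemma qmult_mul l k : (0 < l)%N -> qmult l (l * k)%N = qpoch (q ^+ l) k.
Proof.
move=> l_gt0; elim: k => [|k IHk].
  by rewrite muln0 qpoch0 /qmult big_geq.
rewrite qpochS -IHk -exprM mulnS addnC /qmult.
rewrite (@big_cat_nat _ _ _ (l * k).+1) //=; last by rewrite ltnS leq_addr.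
congr (_ * _); rewrite big_mkcond big_nat_recr /=; last by lia.
rewrite dvdn_add ?dvdn_mulr // big_nat_cond big1 ?mul1r // => j /andP[lt_j _].
rewrite ifN //; apply/negP => /dvdnP[m def_j]; subst j.
have : (k < m < k.+1)%N.
  by rewrite -[(k < m)%N](ltn_pmul2l l_gt0) -[(m < _)%N](ltn_pmul2l l_gt0) mulnS; lia.
lia.
Qed.

Lemma agree_regularF_euler l N M :
  (N <= M)%N -> agree N (regularF l * E) (qmult l M).
Proof.
move=> le_NM; apply: agree_trans (@agree_prod R (dvdn l) _ _ le_NM).
rewrite -/(qmult l N) -npartsF_qpoch; apply: agreeM; last exact: agree_euler.
by move=> n le_n /=; rewrite (nparts_stable _ le_n).
Qed.

Lemma regular5F_euler : regularF 5%N * E = V E.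
Proof.
apply: agreeP => N; have le_N : (N <= 5 * N)%N by lia.
apply: agree_trans (agree_regularF_euler 5%N le_N) _.
rewrite qmult_mul // -dil5_X -dil5_qpoch; apply/agree_sym/(agreeW le_N).
exact/agree_dil5/agree_euler.
Qed.

Hypothesis char11 : 11%:R = 0 :> R.

Lemma regular11F_euler : regularF 11%N * E = E ^+ 11.
Proof.
apply: agreeP => N; have le_N : (N <= 11 * N)%N by lia.
apply: agree_trans (agree_regularF_euler 11%N le_N) _.
have pchar11 : 11%N \in [pchar (fps R)] by rewrite inE /= fps_char11 //= eqxx.
rewrite qmult_mul //; apply: agree_sym.
(* The Frobenius endomorphism gives 1 - q^(11j) = (1 - q^j)^11, the finite form of f_11 = f_1^11. *)
rewrite (_ : qpoch (q ^+ 11) N = qpoch q N ^+ 11); first exact/agreeX/agree_euler.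
rewrite /qpoch -prodrXl; apply: eq_bigr => j _.
by rewrite -!(pFrobenius_autE pchar11) rmorphB rmorph1 -exprM mulnC exprM.
Qed.

Lemma regularF_mul : regularF 5%N * regularF 11%N = E ^+ 9 * V E.
Proof.
apply: (fps_mull (euler0 R)); apply: (fps_mull (euler0 R)).
transitivity ((regularF 5%N * E) * (regularF 11%N * E)); first by ring.
by rewrite regular5F_euler regular11F_euler; ring.
Qed.

Lemma B_coef n : (B 5 11 n)%N%:R = (E ^+ 9 * V E) n :> R.
Proof.
rewrite -regularF_mul B_nparts coef_fpsM natr_sum.
by apply: eq_bigr => i _; rewrite natrM.
Qed.

(** * Iterated sections of f_1^9 f_5 *)

Definition iterU5 f := sect5 2 (sect5 4 f) : fps R.

(** Modulo 11, [sect5 4] maps the span of [g0], [g1] into that of [h0], [h1], and [sect5 2] maps it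
    back. *)
Let g0 := E ^+ 9 * V E.
Let g1 := q * E ^+ 3 * V E ^+ 7.
Let h0 := E ^+ 7 * V E ^+ 3.
Let h1 := q * E * V E ^+ 9.

Lemma sect5_g0 : sect5 4 g0 = 9%:R * h0 + 2%:R * h1.
Proof.
have -> : g0 = V E * E ^+ 9 by rewrite mulrC.
by rewrite sect5_dil5M // sect5_euler9 // /h0 /h1; ring.
Qed.

Lemma sect5_g1 : sect5 4 g1 = 5%:R * h0.
Proof.
have -> : g1 = V (E ^+ 7) * (q * E ^+ 3) by rewrite mulrC rmorphXn.
by rewrite sect5_dil5M // sect5_qEuler3 // /h0; ring.
Qed.

Lemma sect5_h0 : sect5 2 h0 = 3%:R * g0 + 4%:R * g1.
Proof.
have -> : h0 = V (E ^+ 3) * E ^+ 7 by rewrite mulrC rmorphXn.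
by rewrite sect5_dil5M // sect5_euler7 // /g0 /g1; ring.
Qed.

Lemma sect5_h1 : sect5 2 h1 = - g0.
Proof.
have -> : h1 = V (E ^+ 9) * (q * E) by rewrite mulrC rmorphXn.
by rewrite sect5_dil5M // sect5_qEuler // /g0; ring.
Qed.

Lemma sect5_natrM r m (f : fps R) : sect5 r (m%:R * f) = m%:R * sect5 r f.
Proof. by rewrite !mulr_natl raddfMn. Qed.

(** On coordinates, [iterU5] is (m, n) -> (25m + 15n, 36m + 20n), reduced modulo 11. Natural-number
    coordinates let concrete instances be settled by computation. *)
Lemma iterU5_comb (m n m' n' : nat) :
  ((3 * m + 4 * n) %% 11 = m' %% 11)%N -> ((3 * m + 9 * n) %% 11 = n' %% 11)%N ->
  iterU5 (m%:R * g0 + n%:R * g1) = m'%:R * g0 + n'%:R * g1.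
Proof.
have mod11 := natr_mod11 (fps_char11 char11).
move=> e1 e2; rewrite (mod11 m') (mod11 n') -e1 -e2 -!mod11.
rewrite /iterU5 sect5D !sect5_natrM sect5_g0 sect5_g1.
rewrite !(sect5D, sect5_natrM) sect5_h0 sect5_h1.
apply: (eq_mod11 (fps_char11 char11)
  (z := m%:R * (2%:R * g0 + 3%:R * g1) + n%:R * (g0 + g1))).
by ring.
Qed.

Lemma iterU5_5 : iter 5 iterU5 g0 = 10%:R * g0 + 4%:R * g1.
Proof.
transitivity (iter 5 iterU5 (1%:R * g0 + 0%:R * g1)).
  by congr (iter 5 iterU5 _); ring.
rewrite /= (iterU5_comb (m' := 3%N) (n' := 3%N)) //.
rewrite (iterU5_comb (m' := 10%N) (n' := 3%N)) //.
rewrite (iterU5_comb (m' := 9%N) (n' := 2%N)) //.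
rewrite (iterU5_comb (m' := 2%N) (n' := 1%N)) //.
by rewrite (iterU5_comb (m' := 10%N) (n' := 4%N)).
Qed.

Lemma iterU5_6 : iter 6 iterU5 g0 = 2%:R * g0.
Proof.
rewrite iterS iterU5_5 (iterU5_comb (m' := 2%N) (n' := 0%N)) //.
by ring.
Qed.

Lemma iterU5_natrM k m f :
  iter k iterU5 (m%:R * f) = m%:R * iter k iterU5 f.
Proof. by elim: k => //= k ->; rewrite /iterU5 !sect5_natrM. Qed.

Lemma iterU5_6m m : iter (6 * m)%N iterU5 g0 = (2 ^ m)%N%:R * g0.
Proof.
elim: m => [|m IHm]; first by rewrite muln0 mul1r.
by rewrite mulnS iterD IHm iterU5_natrM iterU5_6 expnSr natrM mulrA.
Qed.

(** The coefficient of [h0] is 9 * 10 + 5 * 4 = 110, a multiple of 11; that of [h1] is 2 * 10. *)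
Lemma sect5_iterU5_5 : sect5 4 (iter 5 iterU5 g0) = 9%:R * h1.
Proof.
rewrite iterU5_5 sect5D !sect5_natrM sect5_g0 sect5_g1.
apply: (eq_mod11 (fps_char11 char11) (z := 10%:R * h0 + h1)).
by ring.
Qed.

(** The factor q shifts the exponents 3 and 4 modulo 5, which are absent from f_1, to 4 and 5. *)
Lemma h1_vanish n k : k \in [:: 4; 5]%N -> h1 (5 * n + k)%N = 0.
Proof.
have -> : h1 = q * (V (E ^+ 9) * E) by rewrite rmorphXn /h1 mulrAC mulrA.
have sect0 r j : (2 < r < 5)%N -> (V (E ^+ 9) * E) (5 * j + r)%N = 0.
  move=> r_bounds; rewrite -coef_sect5 sect5_dil5M; last by lia.
  by rewrite sect5_euler0 // mulr0.
by rewrite !inE => /orP[] /eqP ->; rewrite coef_fpsXM addnS; apply: sect0.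
Qed.

Lemma coef_natrM m (f : fps R) n : (m%:R * f : fps R) n = m%:R * f n.
Proof.
by rewrite !mulr_natl; elim: m => // m IHm; rewrite !mulrS coef_fpsD IHm.
Qed.

(** One application of [iterU5] reads the coefficient 25n + 14, and 12(25n + 14) + 7 = 25(12n + 7);
    this form avoids dividing by 12. *)
Lemma coef_iterU5 k f n j : (12 * j + 7 = 25 ^ k * (12 * n + 7))%N ->
  iter k iterU5 f n = f j.
Proof.
elim: k n => [|k IHk] n def_j.
  by congr (fps_coef f _); rewrite expn0 mul1n in def_j; lia.
rewrite iterS /iterU5 !coef_sect5; apply: IHk.
by rewrite def_j expnSr -mulnA; congr (_ * _)%N; lia.
Qed.

End GeneratingFunction.

Theorem theorem1p3 (n m : nat) :
  B 5 11 (5 ^ (12 * m) * n + (7 * 5 ^ (12 * m) - 7) %/ 12)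
    = 2 ^ m * B 5 11 n %[mod 11]
  /\
  forall k : nat, k \in [:: 4; 5] ->
    B 5 11 (5 ^ (12 * m + 12) * n
                + ((12 * k + 11) * 5 ^ (12 * m + 11) - 7) %/ 12)
      = 0 %[mod 11].
Proof.
have char11 : (11%:R = 0 :> 'F_11)%R by apply: pchar_Fp_0.
have eq_mod a b : (a%:R = b%:R :> 'F_11)%R -> a = b %[mod 11].
  by move/(congr1 val); rewrite /= !val_Fp_nat.
have pow25 e : 25 ^ e = 5 ^ (2 * e) by rewrite expnM.
have pow_gt0 e : 0 < 5 ^ e by rewrite expn_gt0.
split=> [|k k45]; apply: eq_mod; rewrite (B_coef char11).
  rewrite -(@coef_iterU5 _ (6 * m) _ n); last first.
    rewrite pow25 mulnA -[2 * 6]/12; have := divnK (dvdn_shift1 m).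
    have := pow_gt0 (12 * m); move: (5 ^ _) (_ %/ 12) => p d; nia.
  by rewrite iterU5_6m // coef_natrM -(B_coef char11) -natrM.
(* After 6m + 5 applications of [iterU5], one more section of residue 4 leads to the coefficient 5n
   + k of a multiple of [h1]. The indices match because 12(5(5n + k) + 4) + 7 = 5(60n + 12k +
   11). *)
rewrite -(@coef_iterU5 _ (5 + 6 * m) _ (5 * (5 * n + k) + 4)).
  rewrite iterD iterU5_6m // iterU5_natrM coef_natrM -coef_sect5.
  by rewrite sect5_iterU5_5 // coef_natrM h1_vanish // !mulr0.
rewrite pow25; have := divnK (dvdn_shift2 k m); move: (_ %/ 12) => d.
have -> : 2 * (5 + 6 * m) = 12 * m + 10 by lia.
have -> : 12 * m + 12 = (12 * m + 10).+2 by lia.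
have -> : 12 * m + 11 = (12 * m + 10).+1 by lia.
have := pow_gt0 (12 * m + 10); rewrite !expnS; move: (5 ^ _) => p; nia.
Qed.
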